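(* Let $m\ge 2$, $\alpha_1,\dots,\alpha_m>0$, and let $\epsilon_1^{0},\dots,\epsilon_m^{0}\in\mathbb{R}^d$ be the zero-sum base noise vectors and $\epsilon_k=\alpha_k\epsilon_k^{0}$ the scaled noise vectors constructed as in the context. Let $\theta\in\mathbb{R}^d$ be the current iterate and let $\Delta^\star:\mathbb{R}^d\to\mathbb{R}^d$ be the displacement map described in the context. Assume that $\Delta^\star$ is Fréchet differentiable in a neighborhood of $\theta$, and that its Jacobian $J(\cdot)$ is $L_J$-Lipschitz in this neighborhood: $$\|J(\vartheta)-J(\vartheta')\|\le L_J\,\|\vartheta-\vartheta'\|.$$ Write $J=J(\theta)$. For $k=1,\dots,m$ let $$\widehat{\Delta}^{(k)}=\Delta^\star(\theta)+J\,\epsilon_k+\rho_k,\qquad \rho_k=\Delta^\star(\theta+\epsilon_k)-\Delta^\star(\theta)-J\,\epsilon_k,$$ and let $$w_k=\frac{\alpha_k^{-1}}{\sum_{j=1}^m\alpha_j^{-1}},\qquad \bar{\Delta}=\sum_{k=1}^m w_k\,\widehat{\Delta}^{(k)}.$$ Then, for every $k$, $$\rho_k=\int_0^1\big(J(\theta+t\,\epsilon_k)-J(\theta)\big)\,\epsilon_k\,dt,\qquad \|\rho_k\|\le\int_0^1 L_J\,t\,\|\epsilon_k\|^2\,dt=\frac{L_J}{2}\|\epsilon_k\|^2,$$ and consequently $$\big\|\bar{\Delta}-\Delta^\star(\theta)\big\|=\Big\|\sum_{k=1}^m w_k\rho_k\Big\|\le\frac{L_J}{2}\sum_{k=1}^m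 w_k\,\|\epsilon_k\|^2 .$$
   Context: $\Delta^\star(\theta)$ denotes the ideal (noise-free) parameter displacement produced by a fixed local training (unlearning) procedure when initialized at parameters $\theta\in\mathbb{R}^d$, with data and algorithmic randomness held fixed, so it is a deterministic map of $\theta$. The vectors $\widehat{\Delta}^{(k)}$ are the displacements returned from $m$ perturbed copies of the parameters, and $\bar\Delta$ is their harmonic-weighted aggregate. The parameter space is decomposed into $L$ blocks, $\mathbb{R}^d=\mathbb{R}^{d_1}\times\cdots\times\mathbb{R}^{d_L}$, with noise scales $\sigma_1,\dots,\sigma_L$. For each block $\ell$ one draws i.i.d. Gaussian vectors $z_{k,\ell}\sim\mathcal{N}(0,\sigma_\ell^2 I_{d_\ell})$, $k=1,\dots,m$, sets $\bar z_\ell=\frac1m\sum_{k=1}^m z_{k,\ell}$, and defines $\epsilon^{0}_{k,\ell}=\sqrt{\tfrac{m}{m-1}}\,(z_{k,\ell}-\bar z_\ell)\in\mathbb{R}^{d_\ell}$. The base noise vector of copy $k$ is the concatenation $\epsilon_k^{0}=(\epsilon^{0}_{k,1},\dots,\epsilon^{0}_{k,L})\in\mathbb{R}^d$, so that $\sum_{k=1}^m\epsilon_k^{0}=0$, and the scaled noise vector is $\epsilon_k=\alpha_k\,\epsilon_k^{0}$. Here $\|\cdot\|$ is the Euclidean norm on $\mathbb{R}^d$ and the induced operator norm on matrices.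
   Formalization: The integral formula and bound for ρ_k are stated when the segment from θ to θ+ε_k lies in the neighborhood where Δ⋆ is differentiable with Lipschitz Jacobian (for all k in the final bound); without this the claim fails, since Gaussian noise can leave the neighborhood. *)

(* Defs.v *)
From HB Require Import structures.
From mathcomp Require Import all_boot all_order all_algebra.
From mathcomp Require Import all_classical all_reals all_analysis.
Set Implicit Arguments.
Unset Strict Implicit.
Unset Printing Implicit Defensive.
Import Order.TTheory GRing.Theory Num.Theory.
Import numFieldNormedType.Exports.
Local Open Scope classical_set_scope.
Local Open Scope ring_scope.

(* The library norm `|x| on 'rV[R]_n is the sup norm. It induces the same
   topology, and the same notions of differentiability and differential, as
   the Euclidean norm, so [nbhs], [differentiable] and ['J] are used as is. *)
Definition enorm (R : realType) (n : nat) (x : 'rV[R]_n) : R :=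
  Num.sqrt (\sum_(i < n) x 0 i ^+ 2).

(* Vectors are rows and ['d f p v = v *m 'J f p], so matrices act on the right:
   this is the Euclidean operator norm of v |-> v *m A. The set is bounded, so
   the [sup] is a true supremum. *)
Definition opnorm (R : realType) (n p : nat) (A : 'M[R]_(n, p)) : R :=
  sup [set enorm (v *m A) | v in [set v : 'rV[R]_n | enorm v <= 1]].

Definition segment (R : realType) (n : nat) (x v : 'rV[R]_n) : set 'rV[R]_n :=
  [set x + t *: v | t in `[0, 1]].

Definition rV_integral (R : realType) (n : nat) (D : set R)
    (f : R -> 'rV[R]_n) : 'rV[R]_n :=
  \row_i \int[lebesgue_measure]_(t in D) f t 0 i.

Definition borel_rV (R : realType) (n : nat) : set (set 'rV[R]_n) :=
  <<s [set A : set 'rV[R]_n | open A] >>.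
Arguments borel_rV : clear implicits.

(* The vectors z_k are random vectors with law N(0, s^2 I_n), the product of n
   copies of N(0, s^2) (given by its values on measurable boxes), and are
   mutually independent; taking some A_k to be the whole space gives the
   product rule for subfamilies. The second argument of [normal_prob] is the
   standard deviation. *)
Definition iid_gaussian (R : realType) (disp : measure_display)
    (T : measurableType disp) (P : probability T R) (m n : nat) (s : R)
    (z : 'I_m -> T -> 'rV[R]_n) : Prop :=
  [/\ forall k (A : set 'rV[R]_n), borel_rV R n A -> measurable (z k @^-1` A),
      forall k (B : 'I_n -> set R), (forall i, measurable (B i)) ->
        P [set w | forall i, B i (z k w 0 i)] =
        (\prod_(i < n) normal_prob (0 : R) s (B i))%E
    & forall A : 'I_m -> set 'rV[R]_n, (forall k, borel_rV R n (A k)) ->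
        P [set w | forall k, A k (z k w)] =
        (\prod_(k < m) P (z k @^-1` A k))%E].

(* R^d is 'rV[R]_(\sum_l d l), a vector being the concatenation [\mxrow_l]
   of its blocks. *)
Definition base_noise (R : realType) (m L : nat) (d : 'I_L -> nat)
    (z : 'I_m -> forall l : 'I_L, 'rV[R]_(d l)) (k : 'I_m) :
    'rV[R]_(\sum_l d l) :=
  \mxrow_l (Num.sqrt (m%:R / (m%:R - 1)) *:
            (z k l - m%:R^-1 *: \sum_(j < m) z j l)).

Definition scaled_noise (R : realType) (m L : nat) (d : 'I_L -> nat)
    (alpha : 'I_m -> R) (z : 'I_m -> forall l : 'I_L, 'rV[R]_(d l))
    (k : 'I_m) : 'rV[R]_(\sum_l d l) :=
  alpha k *: base_noise z k.

Definition weight (R : realType) (m : nat) (alpha : 'I_m -> R) (k : 'I_m) : R :=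
  (alpha k)^-1 / \sum_(j < m) (alpha j)^-1.

Definition remainder (R : realType) (n : nat) (Delta : 'rV[R]_n -> 'rV[R]_n)
    (theta e : 'rV[R]_n) : 'rV[R]_n :=
  Delta (theta + e) - Delta theta - e *m 'J Delta theta.

Definition returned (R : realType) (n : nat) (Delta : 'rV[R]_n -> 'rV[R]_n)
    (theta e : 'rV[R]_n) : 'rV[R]_n :=
  Delta theta + e *m 'J Delta theta + remainder Delta theta e.

Definition aggregate (R : realType) (m n : nat) (alpha : 'I_m -> R)
    (Delta : 'rV[R]_n -> 'rV[R]_n) (theta : 'rV[R]_n)
    (e : 'I_m -> 'rV[R]_n) : 'rV[R]_n :=
  \sum_(k < m) weight alpha k *: returned Delta theta (e k).

(* Main.v *)
Require Import Defs.
From HB Require Import structures.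
From mathcomp Require Import all_boot all_order all_algebra.
From mathcomp Require Import all_classical all_reals all_analysis.
From mathcomp Require Import ring.
Set Implicit Arguments.
Unset Strict Implicit.
Unset Printing Implicit Defensive.
Import Order.TTheory GRing.Theory Num.Theory.
Import numFieldNormedType.Exports.
Local Open Scope classical_set_scope.
Local Open Scope ring_scope.

(* The remainder identity is the fundamental theorem of calculus applied to each
   coordinate of t |-> Delta (theta + t e) - t (e J); the integrand is continuous
   because J is Lipschitz. The Euclidean bound is obtained by duality: for every
   v, the scalar function <Delta (theta + t e) - t (e J), v> - (LJ/2) |e|^2 |v| t^2
   is nonincreasing on [0, 1], so <rho, v> <= (LJ/2) |e|^2 |v|, and v := rho
   gives the norm of rho. In the aggregate, the harmonic weights cancel the
   scales alpha_k, so the linear terms sum to a multiple of the zero-sum base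
   noise. *)

(** * Euclidean inner product, norm and operator norm on row vectors *)

Definition dotv (R : realType) (n : nat) (u v : 'rV[R]_n) : R :=
  \sum_(i < n) u 0 i * v 0 i.

Lemma enorm_ge0 (R : realType) (n : nat) (u : 'rV[R]_n) : 0 <= enorm u.
Proof. exact: sqrtr_ge0. Qed.

Lemma enorm_sqr (R : realType) (n : nat) (u : 'rV[R]_n) :
  enorm u ^+ 2 = dotv u u.
Proof.
rewrite sqr_sqrtr; first by apply: eq_bigr => i _; rewrite expr2.
by apply: sumr_ge0 => i _; exact: sqr_ge0.
Qed.

Lemma dotvZl (R : realType) (n : nat) (a : R) (u v : 'rV[R]_n) :
  dotv (a *: u) v = a * dotv u v.
Proof. by rewrite mulr_sumr; apply: eq_bigr => i _; rewrite mxE mulrA. Qed.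

Lemma dotvBl (R : realType) (n : nat) (u v w : 'rV[R]_n) :
  dotv (u - v) w = dotv u w - dotv v w.
Proof.
by rewrite -sumrB; apply: eq_bigr => i _; rewrite !mxE mulrBl.
Qed.

Lemma dotv_suml (R : realType) (n m : nat) (u : 'I_m -> 'rV[R]_n)
    (v : 'rV[R]_n) : dotv (\sum_k u k) v = \sum_k dotv (u k) v.
Proof.
rewrite exchange_big; apply: eq_bigr => i _ /=.
by rewrite summxE mulr_suml.
Qed.

Lemma dotvC (R : realType) (n : nat) (u v : 'rV[R]_n) : dotv u v = dotv v u.
Proof. by apply: eq_bigr => i _; rewrite mulrC. Qed.

Lemma enormZ (R : realType) (n : nat) (a : R) (u : 'rV[R]_n) :
  enorm (a *: u) = `|a| * enorm u.
Proof.
rewrite /enorm -sqrtr_sqr -sqrtrM ?sqr_ge0// mulr_sumr; congr Num.sqrt.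
by apply: eq_bigr => i _; rewrite mxE exprMn.
Qed.

Lemma enorm0_eq0 (R : realType) (n : nat) (u : 'rV[R]_n) :
  enorm u = 0 -> u = 0.
Proof.
move=> u0; have /psumr_eq0P u0i : \sum_(i < n) u 0 i ^+ 2 = 0.
  by have := enorm_sqr u; rewrite u0 expr0n /dotv /=; under eq_bigr do rewrite -expr2.
apply/rowP => i; rewrite mxE; apply/eqP; rewrite -sqrf_eq0; apply/eqP.
by apply: u0i => // j _; exact: sqr_ge0.
Qed.

Lemma normr_coord_le_enorm (R : realType) (n : nat) (u : 'rV[R]_n) (i : 'I_n) :
  `|u 0 i| <= enorm u.
Proof.
rewrite -sqrtr_sqr ler_wsqrtr// (bigD1 i)//= lerDl.
by apply: sumr_ge0 => j _; exact: sqr_ge0.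
Qed.

(** Cauchy-Schwarz. With [a] and [b] the norms of [u] and [v], the square of the norm of
    [b *: u - a *: v] expands to [2 * (a * b) * (a * b - dotv u v)]; it is nonnegative, and the
    positive factor cancels once zero vectors are set aside. *)
Lemma dotv_le_enorm (R : realType) (n : nat) (u v : 'rV[R]_n) :
  dotv u v <= enorm u * enorm v.
Proof.
have [v0|v0] := eqVneq (enorm v) 0.
  rewrite v0 mulr0 (enorm0_eq0 v0) /dotv big1// => i _.
  by rewrite mxE mulr0.
have vgt0 : 0 < enorm v by rewrite lt_def v0 enorm_ge0.
set b := enorm v; set a := enorm u.
have h : 0 <= enorm (b *: u - a *: v) ^+ 2 by rewrite sqr_ge0.
have [u0|u0] := eqVneq a 0.
  rewrite u0 mul0r (enorm0_eq0 u0) /dotv big1// => i _.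
  by rewrite mxE mul0r.
have ugt0 : 0 < a by rewrite lt_def u0 enorm_ge0.
move: h; rewrite enorm_sqr dotvBl !dotvZl ![dotv _ (_ - _)]dotvC !dotvBl !dotvZl.
rewrite -!enorm_sqr (dotvC v u) -/a -/b => h.
rewrite -(@ler_pM2l _ (2 * (a * b))); last by rewrite !mulr_gt0.
by move: h; rewrite -subr_ge0; congr (_ <= _); ring.
Qed.

(** Duality: test against [v := u] and cancel one factor [enorm u]; [0 <= c] covers [u = 0]. *)
Lemma enorm_le_dotv (R : realType) (n : nat) (u : 'rV[R]_n) (c : R) :
  0 <= c -> (forall v, dotv u v <= c * enorm v) -> enorm u <= c.
Proof.
move=> c0 /(_ u); rewrite -enorm_sqr expr2 => h.
have [->//|u0] := eqVneq (enorm u) 0.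
by rewrite -(@ler_pM2r _ (enorm u))// lt_def u0 enorm_ge0.
Qed.

(** The triangle inequality for nonnegative combinations, by duality: pairing with [v] is linear,
    and each summand is bounded by Cauchy-Schwarz. *)
Lemma enorm_sum_le (R : realType) (n m : nat) (w : 'I_m -> R)
    (u : 'I_m -> 'rV[R]_n) (c : 'I_m -> R) :
  (forall k, 0 <= w k) -> (forall k, enorm (u k) <= c k) ->
  enorm (\sum_k w k *: u k) <= \sum_k w k * c k.
Proof.
move=> w0 uc; apply: enorm_le_dotv => [|v].
  by apply: sumr_ge0 => k _; rewrite mulr_ge0// (le_trans _ (uc k))// enorm_ge0.
rewrite dotv_suml mulr_suml; apply: ler_sum => k _.
rewrite dotvZl -mulrA ler_wpM2l// (le_trans (dotv_le_enorm _ _))//.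
by rewrite ler_wpM2r// enorm_ge0.
Qed.

(** The factor on the right is the Frobenius norm of [A]; the bound is Cauchy-Schwarz on each
    column. It serves to show that the set defining [opnorm] is bounded. *)
Lemma enorm_mulmx_le (R : realType) (n p : nat) (A : 'M[R]_(n, p))
    (v : 'rV[R]_n) :
  enorm (v *m A) <=
  enorm v * Num.sqrt (\sum_(j < p) enorm (row j A^T) ^+ 2).
Proof.
rewrite -[enorm v]ger0_norm ?enorm_ge0// -sqrtr_sqr -sqrtrM ?sqr_ge0//.
rewrite ler_wsqrtr// mulr_sumr; apply: ler_sum => j _.
have -> : (v *m A) 0 j = dotv v (row j A^T).
  by rewrite mxE; apply: eq_bigr => i _; rewrite !mxE.
rewrite -exprMn -ler_sqrt ?sqr_ge0// !sqrtr_sqr [leRHS]ger0_norm; last first.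
  by rewrite mulr_ge0// enorm_ge0.
rewrite ler_norml dotv_le_enorm andbT lerNl -mulN1r -dotvZl.
by rewrite (le_trans (dotv_le_enorm _ _))// enormZ normrN1 mul1r.
Qed.

(** For [v] nonzero, the normalized vector lies in the unit ball. The [sup] dominates its image
    because the set is nonempty (take 0) and bounded by the Frobenius norm. *)
Lemma enorm_mulmx_opnorm (R : realType) (n p : nat) (A : 'M[R]_(n, p))
    (v : 'rV[R]_n) : enorm (v *m A) <= opnorm A * enorm v.
Proof.
have [v0|v0] := eqVneq (enorm v) 0.
  by rewrite (le_trans (enorm_mulmx_le _ _))// v0 mul0r mulr0.
have vgt0 : 0 < enorm v by rewrite lt_def v0 enorm_ge0.
rewrite -ler_pdivrMr// mulrC -[_^-1]ger0_norm ?invr_ge0 ?enorm_ge0// -enormZ scalemxAl.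
apply: sup_upper_bound; last first.
  by exists ((enorm v)^-1 *: v) => //=; rewrite enormZ ger0_norm ?invr_ge0 ?enorm_ge0// mulVf.
split; first by exists (enorm (0 *m A)), 0 => //=; rewrite -(scale0r 0) enormZ normr0 mul0r.
exists (Num.sqrt (\sum_(j < p) enorm (row j A^T) ^+ 2)) => _ [w /= w1 <-].
by rewrite (le_trans (enorm_mulmx_le _ _))// ler_piMl// sqrtr_ge0.
Qed.

(** * Derivatives along a line and the fundamental theorem of calculus *)

(** The two difference quotients are the same function of [h], so no chain rule is involved. *)
Lemma is_derive_line (R : realType) (V W : normedModType R) (f : V -> W)
    (x v : V) (t : R) (df : W) :
  is_derive (x + t *: v) v f df ->
  is_derive t (1 : R) (fun s : R => f (x + s *: v)) df.
Proof.
have E : (fun h : R => h^-1 *: (f (h *: v + (x + t *: v)) - f (x + t *: v))) =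
  (fun h : R => h^-1 *: (f (x + (h *: 1 + t) *: v) - f (x + t *: v))).
  by apply/funext => h; rewrite [h *: 1]mulr1 scalerDl addrCA.
case=> df1 df2; apply: DeriveDef.
  by move: df1; rewrite /derivable /= E.
by move: df2; rewrite /derive /= E.
Qed.

Lemma is_derive_line_coord (R : realType) (n p : nat)
    (f : 'rV[R]_n -> 'rV[R]_p) (x v : 'rV[R]_n) (t : R) (j : 'I_p) :
  differentiable f (x + t *: v) ->
  is_derive t (1 : R) (fun s : R => f (x + s *: v) 0 j)
    ((v *m 'J f (x + t *: v)) 0 j).
Proof.
move=> df; apply: (is_derive_line (f := fun y => f y 0 j)).
have dv : derivable f (x + t *: v) v by exact: diff_derivable.
rewrite -deriveEjacobian// derive_mx// mxE; apply: DeriveDef => //.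
by move/derivable_mxP : dv; exact.
Qed.

(** Two-sided derivatives are asked for at the endpoints too, which yields the one-sided continuity
    of [F] there. *)
Lemma Rintegral_FTC2 (R : realType) (a b : R) (f F : R -> R) : a < b ->
  {within `[a, b], continuous f} ->
  (forall t, t \in `[a, b] -> is_derive t (1 : R) F (f t)) ->
  \int[lebesgue_measure]_(t in `[a, b]) f t = F b - F a.
Proof.
move=> ab cf dF.
have cF t : t \in `[a, b] -> {for t, continuous F}.
  move=> /dF ?; apply/differentiable_continuous/derivable1_diffP; exact: ex_derive.
rewrite /Rintegral (continuous_FTC2 ab cf (F := F))//; last first.
  by move=> t /subset_itv_oo_cc /dF ?; rewrite derive1E derive_val.
split.
- by move=> t /subset_itv_oo_cc /dF ?; exact: ex_derive.
- by apply: cvg_at_right_filter; apply: cF; rewrite in_itv /= lexx ltW.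
- by apply: cvg_at_left_filter; apply: cF; rewrite in_itv /= lexx ltW.
Qed.

(** * First-order Taylor remainder *)

Section taylor.
Context (R : realType) (n : nat) (Delta : 'rV[R]_n -> 'rV[R]_n).
Context (theta e : 'rV[R]_n) (U : set 'rV[R]_n) (LJ : R).
Hypothesis hdiff : forall x, U x -> differentiable Delta x.
Hypothesis hLip : forall x y, U x -> U y ->
  opnorm ('J Delta x - 'J Delta y) <= LJ * enorm (x - y).
Hypothesis hseg : segment theta e `<=` U.

(** The derivative of [t |-> Delta (theta + t *: e) - t *: (e *m 'J Delta theta)]. *)
Let Df (t : R) := e *m ('J Delta (theta + t *: e) - 'J Delta theta).

Let Useg (t : R) : t \in `[0, 1] -> U (theta + t *: e).
Proof. by move=> t01; apply: hseg; exists t. Qed.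

Let enorm_Df (s t : R) : s \in `[0, 1] -> t \in `[0, 1] ->
  enorm (Df s - Df t) <= LJ * `|s - t| * enorm e ^+ 2.
Proof.
move=> s01 t01; rewrite /Df -mulmxBr opprB addrA subrK.
rewrite (le_trans (enorm_mulmx_opnorm _ _))// expr2 mulrA ler_wpM2r ?enorm_ge0//.
rewrite (le_trans (hLip (Useg s01) (Useg t01)))// opprD addrACA subrr add0r.
by rewrite -scalerBl enormZ mulrA.
Qed.

Let Df0 : Df 0 = 0.
Proof. by rewrite /Df scale0r addr0 subrr mulmx0. Qed.

(** The sign of [LJ] is not assumed: the Lipschitz bound between times 1 and 0 puts a norm below
    this product. *)
Lemma Lipschitz_sqr_enorm_ge0 : 0 <= LJ * enorm e ^+ 2.
Proof.
have := @enorm_Df 1 0; rewrite subr0 normr1 mulr1 => h.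
by apply: le_trans (h _ _); rewrite ?enorm_ge0// in_itv /= lexx ler01.
Qed.

Let is_derive_Df (t : R) j : t \in `[0, 1] ->
  is_derive t (1 : R)
    (fun s : R => Delta (theta + s *: e) 0 j - s * (e *m 'J Delta theta) 0 j)
    (Df t 0 j).
Proof.
move=> t01.
have ? := is_derive_line_coord j (hdiff (Useg t01)).
have ? : is_derive t (1 : R) (fun s : R => s * (e *m 'J Delta theta) 0 j)
    ((e *m 'J Delta theta) 0 j).
  rewrite [X in is_derive _ _ X](_ : _ = (e *m 'J Delta theta) 0 j \*: (id : R -> R)).
    by apply: is_derive_eq; rewrite [LHS]mulr1.
  by apply/funext => s /=; rewrite mulrC.
by apply: is_derive_eq; rewrite /Df mulmxBr [in RHS]mxE [(- _ : matrix _ _ _) _ _]mxE.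
Qed.

Lemma remainder_integral :
  remainder Delta theta e = rV_integral `[0, 1] Df.
Proof.
apply/rowP => j; rewrite [RHS]mxE.
rewrite (Rintegral_FTC2 ltr01 _ (fun t => is_derive_Df j)).
  by rewrite scale1r scale0r addr0 mul1r mul0r subr0 /remainder !mxE addrAC.
apply/subspace_continuousP => t t01; apply/cvgrPdist_le => eps eps0.
(* [LJ * enorm e ^+ 2] is a Lipschitz constant of [Df]; adding 1 makes it a positive divisor even
   when it vanishes. *)
have K1 : 0 < LJ * enorm e ^+ 2 + 1 by rewrite ltr_wpDl ?Lipschitz_sqr_enorm_ge0.
near=> s.
have s01 : s \in `[0, 1] by near: s; exact: withinT.
have st : `|t - s| <= eps / (LJ * enorm e ^+ 2 + 1).
  near: s; apply: cvg_within; apply/nbhs_ballP.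
  by exists (eps / (LJ * enorm e ^+ 2 + 1)) => [|s /ltW//]; exact: divr_gt0.
have DfB : Df t 0 j - Df s 0 j = (Df t - Df s) 0 j.
  by rewrite [RHS]mxE [in RHS](mxE _ (fun i k => - _)).
rewrite DfB.
apply: (le_trans (normr_coord_le_enorm (Df t - Df s) j)).
apply: (le_trans (enorm_Df t01 s01)).
rewrite mulrAC (@le_trans _ _ ((LJ * enorm e ^+ 2 + 1) * `|t - s|))//.
  by rewrite ler_wpM2r// lerDl.
by rewrite mulrC -ler_pdivlMr.
Unshelve. all: by end_near. Qed.

Lemma enorm_remainder_le : enorm (remainder Delta theta e) <= LJ / 2 * enorm e ^+ 2.
Proof.
have K0 := Lipschitz_sqr_enorm_ge0.
apply: enorm_le_dotv => [|v]; first by rewrite mulrAC divr_ge0.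
pose q := e *m 'J Delta theta.
pose h (s : R) := \sum_(i < n)
    v 0 i * (Delta (theta + s *: e) 0 i - s * q 0 i)
  - (LJ / 2 * enorm e ^+ 2 * enorm v) * s ^+ 2.
have dh (t : R) : t \in `[0, 1] -> is_derive t (1 : R) h
    (dotv (Df t) v - LJ * t * enorm e ^+ 2 * enorm v).
  move=> t01.
  have ? i := is_derive_Df i t01.
  (* Written as a combination of functions, [h] has its derivative found by instance resolution. *)
  have -> : h = \sum_(i < n)
      v 0 i \*: (fun s : R => Delta (theta + s *: e) 0 i - s * q 0 i)
     - (LJ / 2 * enorm e ^+ 2 * enorm v) \*: (id : R -> R) ^+ 2.
    by apply/funext => s; rewrite /h /= !fctE fct_sumE.
  apply: is_derive_eq; rewrite /dotv; congr (_ - _).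
    by apply: eq_bigr => i _; rewrite mulrC.
  by rewrite /GRing.scale /= expr1 mulr1; field.
have : h 1 <= h 0.
  apply: (@ler0_derive1_le_cc _ h 0 1); rewrite ?in_itv /= ?lexx ?ler01//.
  - by move=> t /subset_itv_oo_cc /dh ?; exact: ex_derive.
  - move=> t /subset_itv_oo_cc t01; have ? := dh _ t01.
    (* Cauchy-Schwarz reduces the sign of the derivative to [enorm (Df t) <= LJ * t * enorm e ^+ 2],
       which is the Lipschitz bound between [t] and 0, as [Df 0 = 0]. *)
    rewrite derive1E derive_val subr_le0 (le_trans (dotv_le_enorm _ _))//.
    have z01 : (0 : R) \in `[0, 1] by rewrite in_itv /= lexx ler01.
    rewrite ler_wpM2r ?enorm_ge0//; have := enorm_Df t01 z01.
    rewrite Df0 !subr0 ger0_norm//.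
    by move: t01; rewrite in_itv /= => /andP[].
  - apply: derivable_within_continuous => t /dh ?; exact: ex_derive.
rewrite /h expr1n expr0n /= mulr0 mulr1 subr0 scale1r scale0r addr0.
rewrite lerBlDl -lerBlDr -sumrB; congr (_ <= _).
apply: eq_bigr => i _; rewrite /remainder !mxE -/q mul1r mul0r; ring.
Qed.
End taylor.

Lemma Rintegral_linear01 (R : realType) (a b : R) :
  \int[lebesgue_measure]_(t in `[0, 1]) (a * t * b) = a / 2 * b.
Proof.
have dF (t : R) : is_derive t (1 : R) (fun s : R => (a / 2 * b) * s ^+ 2)
    (a * t * b).
  rewrite [X in is_derive _ _ X](_ : _ = (a / 2 * b) \*: (id : R -> R) ^+ 2).
    by apply: is_derive_eq; rewrite /GRing.scale /= expr1; field.
  by apply/funext => s; rewrite !fctE.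
rewrite (Rintegral_FTC2 ltr01 _ (fun t _ => dF t)).
  by rewrite expr1n expr0n /= mulr0 mulr1 subr0.
apply: continuous_subspaceT => t.
by apply: continuousM; [apply: continuousM; [exact: cvg_cst|exact: cvg_id]|exact: cvg_cst].
Qed.

(** * Harmonic weights and zero-sum noise *)

(** In each block the common scale factors out, and the deviations from the empirical mean sum to
    zero. *)
Lemma sum_base_noise (R : realType) (m L : nat) (d : 'I_L -> nat)
    (z : 'I_m -> forall l : 'I_L, 'rV[R]_(d l)) : (0 < m)%N ->
  \sum_k base_noise z k = 0.
Proof.
move=> m0; rewrite /base_noise -mxrow_sum -[RHS](mxrow0 _ (q_ := d)).
apply/eq_mxrowP => l; rewrite -scaler_sumr sumrB sumr_const card_ord.
by rewrite -[(_ *: _) *+ m]scaler_nat scalerA mulfV ?scale1r ?subrr ?scaler0// pnatr_eq0 -lt0n.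
Qed.

Section aggregate.
Context (R : realType) (m : nat) (alpha : 'I_m -> R).
Hypothesis m_gt0 : (0 < m)%N.
Hypothesis alpha_gt0 : forall k, 0 < alpha k.

Let sum_inv_gt0 : 0 < \sum_(j < m) (alpha j)^-1.
Proof.
rewrite (bigD1 (Ordinal m_gt0))//= ltr_pwDl ?invr_gt0//.
by apply: sumr_ge0 => j _; rewrite invr_ge0 ltW.
Qed.

Lemma weight_ge0 k : 0 <= weight alpha k.
Proof. by rewrite divr_ge0 ?invr_ge0 ?ltW. Qed.

Lemma sum_weight : \sum_k weight alpha k = 1.
Proof. by rewrite -mulr_suml mulfV ?gt_eqF. Qed.

(** Harmonic weights are chosen for this: [weight alpha k * alpha k] does not depend on [k]. *)
Lemma sum_weight_scaled (n : nat) (e : 'I_m -> 'rV[R]_n) :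
  \sum_k weight alpha k *: (alpha k *: e k) =
  (\sum_(j < m) (alpha j)^-1)^-1 *: \sum_k e k.
Proof.
rewrite scaler_sumr; apply: eq_bigr => k _.
by rewrite scalerA mulrAC mulVf ?mul1r ?gt_eqF.
Qed.

(** The weights sum to 1, so the constant terms give [Delta theta]; the linear terms gather into the
    weighted sum of the [e k] times the Jacobian, which is 0. *)
Lemma aggregate_subr (n : nat) (Delta : 'rV[R]_n -> 'rV[R]_n)
    (theta : 'rV[R]_n) (e : 'I_m -> 'rV[R]_n) :
  \sum_k weight alpha k *: e k = 0 ->
  aggregate alpha Delta theta e - Delta theta =
  \sum_k weight alpha k *: remainder Delta theta (e k).
Proof.
move=> e0; rewrite /aggregate /returned.
under eq_bigr do rewrite 2!scalerDr.
rewrite !big_split/= -scaler_suml sum_weight scale1r.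
under [X in _ + X + _]eq_bigr do rewrite scalemxAl.
rewrite -mulmx_suml e0 mul0mx addr0.
by rewrite addrAC subrr add0r.
Qed.
End aggregate.

Theorem mainTheorem2 (R : realType) (disp : measure_display)
    (T : measurableType disp) (P : probability T R)
    (m L : nat) (d : 'I_L -> nat) (sigma : 'I_L -> R) (alpha : 'I_m -> R)
    (z : 'I_m -> forall l : 'I_L, T -> 'rV[R]_(d l))
    (theta : 'rV[R]_(\sum_l d l))
    (Delta : 'rV[R]_(\sum_l d l) -> 'rV[R]_(\sum_l d l))
    (U : set 'rV[R]_(\sum_l d l)) (LJ : R)
    (hm : (2 <= m)%N)
    (hsigma : forall l, 0 < sigma l)
    (halpha : forall k, 0 < alpha k)
    (hz : forall l, iid_gaussian P (sigma l) (fun k => z k l))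
    (hU : nbhs theta U)
    (hdiff : forall x, U x -> differentiable Delta x)
    (hLip : forall x y, U x -> U y ->
      opnorm ('J Delta x - 'J Delta y) <= LJ * enorm (x - y))
    (omega : T) :
  let eps := scaled_noise alpha (fun k l => z k l omega) in
  let rho := fun k => remainder Delta theta (eps k) in
  let Dbar := aggregate alpha Delta theta eps in
  [/\ (forall k, segment theta (eps k) `<=` U ->
        [/\ rho k = rV_integral `[0, 1]
              (fun t => eps k *m ('J Delta (theta + t *: eps k) - 'J Delta theta)),
            enorm (rho k) <=
              \int[lebesgue_measure]_(t in `[0, 1]) (LJ * t * enorm (eps k) ^+ 2)
          & \int[lebesgue_measure]_(t in `[0, 1]) (LJ * t * enorm (eps k) ^+ 2) =
              LJ / 2 * enorm (eps k) ^+ 2]),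
      enorm (Dbar - Delta theta) = enorm (\sum_(k < m) weight alpha k *: rho k)
    & (forall k, segment theta (eps k) `<=` U) ->
        enorm (\sum_(k < m) weight alpha k *: rho k) <=
          LJ / 2 * \sum_(k < m) weight alpha k * enorm (eps k) ^+ 2].
Proof.
move=> eps rho Dbar.
have m0 : (0 < m)%N by apply: leq_trans hm.
have rho_le k : segment theta (eps k) `<=` U ->
    enorm (rho k) <= LJ / 2 * enorm (eps k) ^+ 2.
  exact: enorm_remainder_le.
have eps0 : \sum_k weight alpha k *: eps k = 0.
  by rewrite sum_weight_scaled// sum_base_noise// scaler0.
split=> [k segU||segU].
(* Evaluating the integral makes the equality trivial and turns the norm bound into [rho_le]. *)
- rewrite Rintegral_linear01; split=> //; last exact: rho_le.
  exact: remainder_integral hdiff hLip segU.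
- by rewrite /Dbar aggregate_subr.
- rewrite mulr_sumr; under [leRHS]eq_bigr do rewrite mulrCA.
  apply: enorm_sum_le => k; first exact: weight_ge0.
  exact: rho_le.
Qed.
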